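(* For a real Banach lattice $E$ the following statements are equivalent. (1) $E$ has the positive Schur property. (2) Every LW-compact operator $T:E\to X$ from $E$ into an arbitrary Banach space $X$ is DW-compact. (3) Every LW-compact operator $T:E\to \ell^\infty$ is DW-compact.
   Context: Operators are bounded and linear. For $A\subset E$, $Sol(A)=\{y\in E: |y|\le |x| \text{ for some } x\in A\}$. A bounded subset $A$ of $E$ is disjointly weakly compact if every disjoint sequence in $Sol(A)$ converges weakly to zero; it is $L$-weakly compact if $\|x_n\|\to 0$ for each disjoint sequence $(x_n)$ in $Sol(A)$. A bounded linear operator from $E$ to a Banach space is DW-compact (resp. LW-compact) if it maps disjointly weakly compact (resp. $L$-weakly compact) subsets of $E$ onto relatively norm compact sets. $E$ has the positive Schur property if every disjoint weakly null sequence in $E$ is norm null (equivalently, every weakly null sequence of $E^+$ is norm null), where $E^+$ is the positive cone of $E$. *)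

(* Defs.v *)
From HB Require Import structures.
From mathcomp Require Import all_boot all_order all_algebra.
From mathcomp Require Import all_classical all_reals all_analysis.

Set Implicit Arguments.
Unset Strict Implicit.
Unset Printing Implicit Defensive.

Import Order.TTheory GRing.Theory Num.Theory.
Import numFieldNormedType.Exports.

Local Open Scope classical_set_scope.
Local Open Scope ring_scope.

(* A real Banach lattice: a real Banach space with a lattice order compatible
   with the vector space structure and a norm monotone for the modulus
   x \/ (- x).  The order is not an instance of [Order.Lattice]: joining that
   class with [CompleteNormedModule] would require inserting join classes below
   existing classes such as [Num.POrderedZmodule]. *)
HB.mixin Record isBanachLattice (R : realType) E of CompleteNormedModule R E := {
  vle : rel E ;
  vsup : E -> E -> E ;
  vinf : E -> E -> E ;
  vle_refl : reflexive vle ;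
  vle_anti : antisymmetric vle ;
  vle_trans : transitive vle ;
  vle_supP : forall x y z : E, vle (vsup x y) z = vle x z && vle y z ;
  vle_infP : forall x y z : E, vle z (vinf x y) = vle z x && vle z y ;
  vle_addr : forall x y z : E, vle x y -> vle (x + z) (y + z) ;
  vle_scale : forall (a : R) (x y : E), 0 <= a -> vle x y -> vle (a *: x) (a *: y) ;
  vle_norm : forall x y : E,
    vle (vsup x (- x)) (vsup y (- y)) -> `|x| <= `|y|
}.

#[short(type="banachLatticeType")]
HB.structure Definition BanachLattice (R : realType) :=
  {E of CompleteNormedModule R E & isBanachLattice R E}.

Section BanachLatticeDefs.
Context {R : realType} {E : banachLatticeType R}.
Implicit Types (x y : E) (A : set E) (u : nat -> E).

(* The modulus |x|, an element of E; the notation `|x| is the norm of x. *)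
Definition modulus x : E := vsup x (- x).

Definition disjoint_elts x y : Prop := vinf (modulus x) (modulus y) = 0.

Definition disjoint_seq u : Prop :=
  forall m n, m != n -> disjoint_elts (u m) (u n).

Definition Sol A : set E := [set y | exists2 x, A x & vle (modulus y) (modulus x)].

End BanachLatticeDefs.

Definition bounded_operator (R : realType) (V W : normedModType R)
    (T : {linear V -> W}) : Prop :=
  exists M : R, forall x : V, `|T x| <= M * `|x|.

Definition weakly_cvg (R : realType) (V : normedModType R)
    (u : nat -> V) (l : V) : Prop :=
  forall f : {linear V -> R^o}, bounded_operator f -> (f \o u) @ \oo --> f l.

Section Compactness.
Context {R : realType} {E : banachLatticeType R}.
Implicit Types (A : set E) (u : nat -> E).

Definition disjointly_weakly_compact A : Prop :=
  bounded_set A /\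
  forall u, (forall n, Sol A (u n)) -> disjoint_seq u -> weakly_cvg u 0.

Definition L_weakly_compact A : Prop :=
  bounded_set A /\
  forall u, (forall n, Sol A (u n)) -> disjoint_seq u ->
    (fun n => `|u n|) @ \oo --> (0 : R).

Definition DW_compact (X : completeNormedModType R) (T : {linear E -> X}) : Prop :=
  bounded_operator T /\
  forall A, disjointly_weakly_compact A -> precompact (T @` A).

Definition LW_compact (X : completeNormedModType R) (T : {linear E -> X}) : Prop :=
  bounded_operator T /\
  forall A, L_weakly_compact A -> precompact (T @` A).

End Compactness.

Definition positive_Schur (R : realType) (E : banachLatticeType R) : Prop :=
  forall u : nat -> E, disjoint_seq u -> weakly_cvg u 0 ->
    (fun n => `|u n|) @ \oo --> (0 : R).

(* The Banach space of bounded real sequences with the supremum norm. *)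
Section Linfty.
Context {R : realType}.

Definition bounded_seq : {pred nat -> R^o} :=
  [pred u | `[< exists M : R, forall n, `|u n| <= M >]].

Lemma bounded_seqP (u : nat -> R^o) :
  u \in bounded_seq <-> exists M : R, forall n, `|u n| <= M.
Proof. by rewrite unfold_in; split => [/asboolP|/asboolP]. Qed.

Lemma bounded_seq_submod_closed : submod_closed bounded_seq.
Proof.
split; first by apply/bounded_seqP; exists 0 => n; rewrite normr0.
move=> a u v /bounded_seqP[M uM] /bounded_seqP[N vN].
apply/bounded_seqP; exists (`|a| * M + N) => n.
rewrite (le_trans (ler_normD _ _))// lerD//.
by rewrite [X in `|X|]/(_ *: _)/= normrM ler_wpM2l.
Qed.

HB.instance Definition _ :=
  GRing.isSubmodClosed.Build R (nat -> R^o) bounded_seq bounded_seq_submod_closed.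

Record linfty := Linfty {
  linfty_val :> nat -> R^o ;
  linfty_valP : linfty_val \in bounded_seq }.

HB.instance Definition _ := [isSub for linfty_val].
HB.instance Definition _ := [Choice of linfty by <:].
HB.instance Definition _ := [SubChoice_isSubLmodule of linfty by <:].

Definition linfty_norm (u : linfty) : R := sup (range (fun n => `|u n|)).

Lemma linfty_has_sup (u : linfty) : has_sup (range (fun n => `|u n|)).
Proof.
split; first by exists `|u 0%N|, 0%N.
by have [M uM] := (bounded_seqP _).1 (linfty_valP u); exists M => _ [n _ <-].
Qed.

Lemma le_linfty_norm (u : linfty) n : `|u n| <= linfty_norm u.
Proof. by apply: sup_upper_bound; [exact: linfty_has_sup|exists n]. Qed.

Lemma linfty_norm_le (u : linfty) (M : R) :
  (forall n, `|u n| <= M) -> linfty_norm u <= M.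
Proof.
move=> uM; apply: ge_sup; first by case: (linfty_has_sup u).
by move=> _ [n _ <-].
Qed.

Lemma linfty_normD (u v : linfty) :
  linfty_norm (u + v) <= linfty_norm u + linfty_norm v.
Proof.
apply: linfty_norm_le => n.
by rewrite (le_trans (ler_normD _ _))// lerD// le_linfty_norm.
Qed.

Lemma linfty_normZ (a : R) (u : linfty) :
  linfty_norm (a *: u) = `|a| * linfty_norm u.
Proof.
have normZ n : `|(a *: u) n| = `|a| * `|u n| by rewrite -normrM.
have [->|a0] := eqVneq a 0.
  rewrite normr0 mul0r; apply/eqP; rewrite eq_le; apply/andP; split.
    by apply: linfty_norm_le => n; rewrite scale0r normr0.
  exact: le_trans (le_linfty_norm _ 0%N).
apply/eqP; rewrite eq_le; apply/andP; split.
  by apply: linfty_norm_le => n; rewrite normZ ler_wpM2l// le_linfty_norm.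
rewrite -ler_pdivlMl ?normr_gt0//; apply: linfty_norm_le => n.
by rewrite ler_pdivlMl ?normr_gt0// -normZ le_linfty_norm.
Qed.

Lemma linfty_norm0_eq0 (u : linfty) : linfty_norm u = 0 -> u = 0.
Proof.
move=> u0; apply/val_inj/funext => n; apply/eqP.
by rewrite -normr_le0 -u0 le_linfty_norm.
Qed.

HB.instance Definition _ :=
  Lmodule_isNormed.Build R linfty linfty_normD linfty_normZ linfty_norm0_eq0.

Lemma linfty_complete (F : set_system linfty) :
  ProperFilter F -> cauchy F -> cvg F.
Proof.
move=> FF /cauchyP Fc.
have Fc' (e : R) : 0 < e -> exists2 u, F [set v | `|u - v| < e] & True.
  by move=> /Fc[u]; rewrite -ball_normE => Fu; exists u.
have coord n : cvg ((fun u : linfty => u n) @ F).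
  apply: cauchy_cvg; apply/cauchyP => e e0.
  have [u Fu _] := Fc' e e0; exists (u n).
  change (F [set v : linfty | ball (u n) e (v n)]).
  apply: filterS Fu => v uv; rewrite -ball_normE /=.
  exact: le_lt_trans (le_linfty_norm (u - v) n) uv.
pose l : nat -> R^o := fun n => lim ((fun u : linfty => u n) @ F).
have close (e : R) (u : linfty) : F [set v | `|u - v| < e] ->
    forall n, `|u n - l n| <= e.
  move=> Fu n.
  have cl : (fun v : linfty => `|u n - v n|) @ F --> `|u n - l n|.
    by apply: cvg_norm; apply: cvgB; [exact: cvg_cst|exact: coord].
  apply: (closed_cvg (fun x => x <= e) _ _ _ cl); first exact: closed_le.
  by apply: filterS Fu => v /ltW; exact: le_trans (le_linfty_norm (u - v) n).
have lb : l \in bounded_seq.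
  have [u /close uP _] := Fc' 1 ltr01.
  apply/bounded_seqP; exists (1 + `|u|) => n.
  rewrite -[l n](subrK (u n)) (le_trans (ler_normD _ _))// lerD//.
    by rewrite distrC.
  exact: le_linfty_norm.
apply/cvg_ex; exists (Linfty lb); apply/cvgrPdist_le => e e0.
have e20 : 0 < e / 2 by rewrite divr_gt0.
have [u Fu _] := Fc' _ e20.
apply: filterS (Fu) => v uv; rewrite -[Linfty lb](subrK u) -addrA.
rewrite (le_trans (ler_normD _ _))// (splitr e) lerD//; last exact: ltW.
apply: linfty_norm_le => n; rewrite distrC; exact: close.
Qed.

HB.instance Definition _ := Uniform_isComplete.Build linfty linfty_complete.

End Linfty.

Arguments linfty R : clear implicits.

(* Main.v *)
Require Import Defs.
From HB Require Import structures.
From mathcomp Require Import all_boot all_order all_algebra.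
From mathcomp Require Import all_classical all_reals all_analysis.
From mathcomp Require Import lra.

(* If E has the positive Schur property, disjointly weakly compact sets are
   L-weakly compact, so every LW-compact operator is DW-compact.  Conversely,
   let (u_n) be a disjoint weakly null sequence, which may be assumed bounded.
   The seminorm q_n(x) = sup_k || |x| /\ k |u_n| || is at most ||x|| and takes the
   value ||u_n|| at u_n; Hahn-Banach gives functionals f_n with |f_n| <= q_n and
   f_n(u_n) = ||u_n||, and T x = (f_n(x))_n maps E to l^oo.  If A is L-weakly
   compact then sup_A q_n -> 0, since the elements |x_n| /\ k_n |u_n| form a
   disjoint sequence in Sol(A); so T(A) lies in a compact box and T is
   LW-compact.  The range of (u_n) is disjointly weakly compact, because
   |f|(|u_n|) -> 0 for every bounded functional f, so T maps it to a relatively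
   compact set.  The coordinates of (T u_n) tend to 0, hence
   ||u_n|| <= ||T u_n|| -> 0. *)

Set Implicit Arguments.
Unset Strict Implicit.
Unset Printing Implicit Defensive.

Import Order.TTheory GRing.Theory Num.Theory.
Import numFieldNormedType.Exports.

Local Open Scope classical_set_scope.
Local Open Scope ring_scope.

(** * The Hahn-Banach and Mazur-Orlicz theorems *)

Section HahnBanach.
Context {R : realType} {V : lmodType R}.
Implicit Types (p q : V -> R) (S : set (V * R)).

(** Homogeneity is asked only as an inequality; equality follows by also scaling by [a^-1]. *)
Definition sublinear p : Prop :=
  (forall x y, p (x + y) <= p x + p y) /\
  (forall a x, 0 <= a -> p (a *: x) <= a * p x).

(** A pair [(y, c)] encodes the constraint [c <= f y] on a functional [f] to be found. *)
Definition cone S : Prop :=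
  [/\ S 0, forall u v, S u -> S v -> S (u + v) &
      forall (a : R) u, 0 <= a -> S u -> S (a *: u.1, a * u.2)].

Lemma sublinear0 p : sublinear p -> p 0 = 0.
Proof.
move=> [pD pZ]; apply/eqP; rewrite eq_le; apply/andP; split.
  by have := pZ 0 0 (lexx _); rewrite scale0r mul0r.
by have := pD 0 0; rewrite addr0; lra.
Qed.

Lemma sublinearZ p a x : sublinear p -> 0 <= a -> p (a *: x) = a * p x.
Proof.
move=> sp; rewrite le_eqVlt => /predU1P[<-|a0].
  by rewrite scale0r mul0r sublinear0.
apply/eqP; rewrite eq_le (sp.2 _ _ (ltW a0))/=.
have := sp.2 a^-1 (a *: x); rewrite invr_ge0 ltW// => /(_ isT).
by rewrite scalerA mulVf ?gt_eqF// scale1r ler_pdivlMl.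
Qed.

Lemma sublinearN_ge p x : sublinear p -> - p (- x) <= p x.
Proof.
by move=> sp; have := sp.1 x (- x); rewrite subrr sublinear0//; lra.
Qed.

(** For [p] and [S] as assumed below, a linear [f] lies under this function exactly when [f <= p]
    and [u.2 <= f u.1] for all [u] in [S]. *)
Definition envelope p S (x : V) : R := inf [set p (x + u.1) - u.2 | u in S].

Section envelope.
Variables (p : V -> R) (S : set (V * R)).
Hypotheses (sp : sublinear p) (cS : cone S) (Sp : forall u, S u -> u.2 <= p u.1).

(** Subadditivity gives [p u.1 <= p (x + u.1) + p (- x)], and [u.2 <= p u.1]; the infimum is
    therefore a genuine one. *)
Lemma envelope_lbound x : lbound [set p (x + u.1) - u.2 | u in S] (- p (- x)).
Proof.
move=> _ [u Su <-]; have := Sp Su.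
by have := sp.1 (x + u.1) (- x); rewrite addrAC subrr add0r; lra.
Qed.

Lemma envelope_le x u : S u -> envelope p S x <= p (x + u.1) - u.2.
Proof.
by move=> Su; apply: ge_inf; [exists (- p (- x)); exact: envelope_lbound|exists u].
Qed.

Lemma le_envelope x r :
  (forall u, S u -> r <= p (x + u.1) - u.2) -> r <= envelope p S x.
Proof.
move=> rS; apply: lb_le_inf; last by move=> _ [u Su <-]; exact: rS.
by case: cS => S0 _ _; exists (p (x + 0) - 0), 0.
Qed.

Lemma envelope_sublinear : sublinear (envelope p S).
Proof.
have [S0 SD SZ] := cS; split=> [x y|a x].
  rewrite -lerBlDr; apply: le_envelope => u Su.
  rewrite lerBlDr [leRHS]addrC -lerBlDr; apply: le_envelope => v Sv.
  rewrite lerBlDr (le_trans (envelope_le _ (SD _ _ Su Sv)))//=.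
  by have := sp.1 (x + u.1) (y + v.1); rewrite addrACA; lra.
rewrite le_eqVlt => /predU1P[<-|a0].
  rewrite scale0r mul0r (le_trans (envelope_le _ S0))//=.
  by rewrite addr0 sublinear0// subr0.
rewrite mulrC -ler_pdivrMr//; apply: le_envelope => u Su.
rewrite ler_pdivrMr// (le_trans (envelope_le _ (SZ _ _ (ltW a0) Su)))//=.
by rewrite -scalerDr; have := sp.2 a (x + u.1) (ltW a0); lra.
Qed.

Lemma envelope_le_id x : envelope p S x <= p x.
Proof.
by case: cS => S0 _ _; rewrite (le_trans (envelope_le _ S0))//= addr0 subr0.
Qed.

Lemma envelopeN_le u : S u -> envelope p S (- u.1) <= - u.2.
Proof.
by move=> /(envelope_le (- u.1)); rewrite addNr sublinear0// sub0r.
Qed.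

End envelope.

(** Zorn's lemma: a chain of sublinear functions under [p] is bounded below by its pointwise
    infimum, finite because every member is at least [- p (- x)] at [x]. *)
Lemma minimal_sublinear p : sublinear p ->
  exists q, [/\ sublinear q, forall x, q x <= p x &
    forall q', sublinear q' -> (forall x, q' x <= q x) -> q' = q].
Proof.
move=> sp; pose T := {q : V -> R | sublinear q /\ forall x, q x <= p x}.
(* The order is reversed, so that a maximal element is a minimal function. *)
pose below (q q' : T) := `[< forall x, sval q' x <= sval q x >].
have [|||A Atot|[q [sq qp]] qmin] := @Zorn T below.
- by move=> q; apply/asboolP => x.
- move=> q1 q2 q3 /asboolP le12 /asboolP le23; apply/asboolP => x.
  exact: le_trans (le23 x) (le12 x).
- move=> q1 q2 /asboolP le12 /asboolP le21.
  apply: eq_sig_hprop => [? ? ?|]; first exact: Prop_irrelevance.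
  by apply: funext => x; apply/eqP; rewrite eq_le le12 le21.
- have [A0|/set0P[q0 Aq0]] := eqVneq A set0.
    by exists (exist _ p (conj sp (fun x => lexx (p x)))) => q; rewrite A0.
  pose B x := [set sval q x | q in A].
  have Blb x : lbound (B x) (- p (- x)).
    move=> _ [[q [sq qp]] _ <-] /=; rewrite (le_trans _ (sublinearN_ge x sq))//.
    by rewrite lerN2.
  pose m x := inf (B x).
  have mle (q : T) x : A q -> m x <= sval q x.
    by move=> Aq; apply: ge_inf; [exists (- p (- x)); exact: Blb|exists q].
  have lem x r : (forall q : T, A q -> r <= sval q x) -> r <= m x.
    move=> rA; apply: lb_le_inf; first by exists (sval q0 x), q0.
    by move=> _ [q Aq <-]; exact: rA.
  have sm : sublinear m.
    split=> [x y|a x a0].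
      rewrite -lerBlDr; apply: (lem) => q Aq.
      rewrite lerBlDr [leRHS]addrC -lerBlDr; apply: (lem) => q' Aq'.
      (* The smaller of [q] and [q'] is subadditive and bounds [m] at [x + y]. *)
      rewrite lerBlDr; have [/asboolP qq'|/asboolP q'q] := Atot _ _ Aq Aq'.
        rewrite (le_trans (mle _ _ Aq'))// (le_trans ((svalP q').1.1 _ _))//.
        by rewrite [leLHS]addrC lerD2l.
      rewrite (le_trans (mle _ _ Aq))// (le_trans ((svalP q).1.1 _ _))//.
      by rewrite [leLHS]addrC lerD2r.
    move: a0; rewrite le_eqVlt => /predU1P[<-|a0].
      rewrite mul0r (le_trans (mle _ _ Aq0))//.
      by rewrite (le_trans ((svalP q0).1.2 _ _ _))// mul0r.
    rewrite mulrC -ler_pdivrMr//; apply: (lem) => q Aq.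
    rewrite ler_pdivrMr// mulrC (le_trans (mle _ _ Aq))//.
    exact: ((svalP q).1.2 _ _ (ltW a0)).
  have mp x : m x <= p x by exact: le_trans (mle _ _ Aq0) ((svalP q0).2 x).
  by exists (exist _ m (conj sm mp)) => q Aq; apply/asboolP => x; exact: mle.
- exists q; split=> // q' sq' q'q.
  have q'p x : q' x <= p x by exact: le_trans (q'q x) (qp x).
  by have /(_ (asboolT q'q))/(congr1 sval) := qmin (exist _ q' (conj sq' q'p)).
Qed.

Lemma ray_cone (y : V) (c : R) :
  cone [set (t *: y, t * c) | t in [set t | 0 <= t]].
Proof.
split=> [|_ _ [s s0 <-] [t t0 <-]|a _ a0 [t t0 <-]].
- by exists 0; rewrite /= ?scale0r ?mul0r.
- by exists (s + t); [rewrite /= addr_ge0|rewrite scalerDl mulrDl].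
- by exists (a * t); [rewrite /= mulr_ge0|rewrite scalerA mulrA].
Qed.

Lemma ray_le p (y : V) (c : R) : sublinear p -> c <= p y ->
  forall u, [set (t *: y, t * c) | t in [set t | 0 <= t]] u -> u.2 <= p u.1.
Proof.
by move=> sp cpy _ [t t0 <-]; rewrite /= sublinearZ// ler_wpM2l.
Qed.

(* A minimal [q] equals its envelope along the ray through [(y, q y)], which
   gives [q x <= q (x + y) - q y]: it is superadditive, hence linear. *)
Lemma hahn_banach p : sublinear p ->
  exists f : {linear V -> R^o}, forall x, f x <= p x.
Proof.
move=> /minimal_sublinear[q [sq qp qmin]].
have qD x y : q (x + y) = q x + q y.
  apply/eqP; rewrite eq_le sq.1/= -lerBrDr.
  have rayq := ray_le sq (lexx (q y)).
  rewrite -{1}(qmin _ (envelope_sublinear sq (ray_cone _ _) rayq)); last first.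
    by move=> z; exact: (envelope_le_id sq (ray_cone _ _) rayq).
  have := @envelope_le _ _ sq rayq x (y, q y); apply.
  by exists 1; rewrite /= ?scale1r ?mul1r.
have qN x : q (- x) = - q x.
  by apply/eqP; rewrite -addr_eq0 -qD addNr sublinear0.
have qZp a x : 0 <= a -> q (a *: x) = a * q x.
  move=> a0; apply/eqP; rewrite eq_le sq.2//=.
  by have := sq.2 a (- x) a0; rewrite scalerN !qN mulrN lerN2.
have qZ a x : q (a *: x) = a * q x.
  have [/qZp//|a0] := leP 0 a.
  by rewrite -[a]opprK scaleNr qN qZp ?mulNr// oppr_ge0 ltW.
have qlin : linear (q : V -> R^o) by move=> a x y; rewrite qD qZ.
pose F := GRing.isLinear.Build R V R^o *:%R q qlin.
by exists (HB.pack_for {linear V -> R^o} q F).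
Qed.

(** A linear functional under the envelope is under [p], and its value at [- u.1] is at most
    [- u.2]. *)
Lemma mazur_orlicz p S : sublinear p -> cone S ->
  (forall u, S u -> u.2 <= p u.1) ->
  exists f : {linear V -> R^o},
    (forall x, f x <= p x) /\ (forall u, S u -> u.2 <= f u.1).
Proof.
move=> sp cS Sp; have [f fp] := hahn_banach (envelope_sublinear sp cS Sp).
exists f; split=> [x|u Su].
  exact: le_trans (fp x) (envelope_le_id sp cS Sp x).
by rewrite -lerN2 -linearN (le_trans (fp _))//; exact: envelopeN_le.
Qed.

Lemma hahn_banach_at p (y : V) : sublinear p ->
  exists f : {linear V -> R^o}, (forall x, f x <= p x) /\ p y <= f y.
Proof.
move=> sp; have raylep := ray_le sp (lexx (p y)).
have [f [fp fS]] := mazur_orlicz sp (ray_cone _ _) raylep.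
exists f; split => //; have := fS (y, p y); apply.
by exists 1; rewrite /= ?scale1r ?mul1r.
Qed.

Lemma linear_norm_le p (f : {linear V -> R^o}) :
  (forall x, p (- x) = p x) -> (forall x, f x <= p x) -> forall x, `|f x| <= p x.
Proof.
by move=> pN fp x; rewrite ler_norml fp lerNl -linearN -pN fp.
Qed.

End HahnBanach.

(** * Banach lattices *)

Section BanachLatticeTheory.
Context {R : realType} {E : banachLatticeType R}.
Implicit Types x y z w : E.

Local Notation "x <=v y" := (vle x y) (at level 70).
Local Notation "x `\/` y" := (vsup x y) (at level 45).
Local Notation "x `/\` y" := (vinf x y) (at level 44).
Local Notation "|` x |" := (modulus x) (at level 0, x at level 99).

Lemma vle_le_trans y x z : x <=v y -> y <=v z -> x <=v z.
Proof. exact: vle_trans. Qed.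

Lemma vle_subr_addr x y z : (x <=v y - z) = (x + z <=v y).
Proof.
apply/idP/idP => [xyz|xzy].
  by have := vle_addr _ _ z xyz; rewrite subrK.
by have := vle_addr _ _ (- z) xzy; rewrite addrK.
Qed.

Lemma vle_subl_addr x y z : (x - z <=v y) = (x <=v y + z).
Proof. by rewrite -{2}[z]opprK vle_subr_addr. Qed.

Lemma vleN x y : (- x <=v - y) = (y <=v x).
Proof. by rewrite -[- x]add0r vle_subl_addr addrC vle_subr_addr add0r. Qed.

Lemma vle_add x y z w : x <=v y -> z <=v w -> x + z <=v y + w.
Proof.
move=> xy zw; apply: vle_le_trans (vle_addr _ _ z xy) _.
by rewrite ![y + _]addrC; exact: vle_addr.
Qed.

Lemma vle_scalePl (a : R) x y : 0 < a -> (a *: x <=v a *: y) = (x <=v y).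
Proof.
move=> a0; apply/idP/idP => [|]; last by apply: vle_scale; exact: ltW.
have ai0 : 0 <= a^-1 by rewrite invr_ge0 ltW.
move=> axy; have := vle_scale _ _ _ ai0 axy.
by rewrite !scalerA mulVf ?gt_eqF// !scale1r.
Qed.

Lemma vle_scale2r (a b : R) x : a <= b -> 0 <=v x -> a *: x <=v b *: x.
Proof.
move=> ab x0; rewrite -[a *: x]add0r -vle_subr_addr -scalerBl.
by rewrite -(scaler0 _ (b - a)) vle_scale// subr_ge0.
Qed.

Lemma vle_addl x y : 0 <=v x -> y <=v x + y.
Proof. by move=> x0; rewrite -vle_subl_addr subrr. Qed.

Lemma vle_supl x y : x <=v x `\/` y.
Proof. by have := vle_refl (x `\/` y); rewrite vle_supP => /andP[]. Qed.

Lemma vle_supr x y : y <=v x `\/` y.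
Proof. by have := vle_refl (x `\/` y); rewrite vle_supP => /andP[]. Qed.

Lemma vinf_lel x y : x `/\` y <=v x.
Proof. by have := vle_refl (x `/\` y); rewrite vle_infP => /andP[]. Qed.

Lemma vinf_ler x y : x `/\` y <=v y.
Proof. by have := vle_refl (x `/\` y); rewrite vle_infP => /andP[]. Qed.

Lemma vle_supC x y : x `\/` y <=v y `\/` x.
Proof. by rewrite vle_supP vle_supl vle_supr. Qed.

Lemma vsupC x y : x `\/` y = y `\/` x.
Proof. by apply: vle_anti; rewrite !vle_supC. Qed.

Lemma vinfC x y : x `/\` y = y `/\` x.
Proof. by apply: vle_anti; rewrite !vle_infP !vinf_lel !vinf_ler. Qed.

Lemma vle_inf2 x y z w : x <=v y -> z <=v w -> x `/\` z <=v y `/\` w.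
Proof.
move=> xy zw; rewrite vle_infP; apply/andP; split.
  exact: vle_le_trans (vinf_lel _ _) xy.
exact: vle_le_trans (vinf_ler _ _) zw.
Qed.

Lemma vinf_add_sup x y : x `/\` y + x `\/` y = x + y.
Proof.
apply: vle_anti; apply/andP; split.
  rewrite [X in X <=v _]addrC -vle_subr_addr vle_supP; apply/andP; split.
    by rewrite vle_subr_addr vle_add ?vle_refl ?vinf_ler.
  by rewrite vle_subr_addr addrC vle_add ?vle_refl ?vinf_lel.
rewrite -vle_subl_addr vle_infP; apply/andP; split.
  by rewrite vle_subl_addr vle_add ?vle_refl ?vle_supr.
by rewrite vle_subl_addr addrC vle_add ?vle_refl ?vle_supl.
Qed.

Lemma vle_modulus x : x <=v |`x|.
Proof. exact: vle_supl. Qed.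

Lemma vleN_modulus x : - x <=v |`x|.
Proof. exact: vle_supr. Qed.

Lemma modulus_le x y : (|`x| <=v y) = (x <=v y) && (- x <=v y).
Proof. exact: vle_supP. Qed.

Lemma modulus_ge0 x : 0 <=v |`x|.
Proof.
(* Twice the modulus dominates [x + (- x) = 0]. *)
rewrite -(@vle_scalePl 2)// scaler0 scaler_nat mulr2n.
by rewrite -(subrr x) vle_add ?vle_modulus ?vleN_modulus.
Qed.

Lemma modulusN x : |`- x| = |`x|.
Proof. by rewrite /modulus opprK vsupC. Qed.

Lemma ger0_modulus x : 0 <=v x -> |`x| = x.
Proof.
move=> x0; apply: vle_anti; rewrite vle_modulus modulus_le vle_refl/= andbT.
by apply: (vle_le_trans _ x0); rewrite -oppr0 vleN.
Qed.

Lemma modulus_id x : |`|`x| | = |`x|.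
Proof. exact: ger0_modulus (modulus_ge0 x). Qed.

Lemma modulus0 : |`(0 : E)| = 0.
Proof. exact: ger0_modulus (vle_refl 0). Qed.

Lemma modulusD x y : |`x + y| <=v |`x| + |`y|.
Proof.
by rewrite modulus_le opprD !vle_add ?vle_modulus ?vleN_modulus.
Qed.

Lemma modulusZ (a : R) x : |`a *: x| = `|a| *: |`x|.
Proof.
have le b z : |`b *: z| <=v `|b| *: |`z|.
  have leb c : 0 <= c -> |`c *: z| <=v c *: |`z|.
    move=> c0; rewrite modulus_le -scalerN.
    by rewrite !vle_scale ?vle_modulus ?vleN_modulus.
  have [b0|b0] := leP 0 b; first by rewrite ger0_norm ?leb.
  by rewrite -modulusN -scaleNr ltr0_norm ?leb// oppr_ge0 ltW.
have [->|a0] := eqVneq a 0; first by rewrite normr0 !scale0r modulus0.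
apply: vle_anti; rewrite le/=.
(* The reverse inequality is [le] for the scalar [a^-1] and the vector [a *: x]. *)
rewrite -(@vle_scalePl `|a|^-1) ?invr_gt0 ?normr_gt0//.
rewrite scalerA mulVf ?normr_eq0// scale1r -normfV.
by have := le a^-1 (a *: x); rewrite scalerA mulVf// scale1r.
Qed.

Lemma norm_modulus x : `| |`x| | = `|x|.
Proof.
by apply/eqP; rewrite eq_le !vle_norm// -!/(modulus _) modulus_id vle_refl.
Qed.

Lemma vinf_ge0 x y : 0 <=v x -> 0 <=v y -> 0 <=v x `/\` y.
Proof. by move=> x0 y0; rewrite vle_infP x0 y0. Qed.

Lemma vle_infD x y z : 0 <=v x -> 0 <=v y -> 0 <=v z ->
  (x + y) `/\` z <=v x `/\` z + y `/\` z.
Proof.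
move=> x0 y0 z0; rewrite -vle_subl_addr vle_infP; apply/andP; split.
  rewrite vle_subl_addr [X in _ <=v X]addrC -vle_subl_addr vle_infP.
  apply/andP; split; first by rewrite vle_subl_addr [X in _ <=v X]addrC vinf_lel.
  rewrite vle_subl_addr (vle_le_trans (vinf_ler _ _))//.
  by rewrite -{1}[z]addr0 vle_add// vle_refl.
rewrite vle_subl_addr (vle_le_trans (vinf_ler _ _))//.
by rewrite -{1}[z]addr0 vle_add ?vle_refl// vinf_ge0.
Qed.

Lemma vinf_scale (a : R) x y : 0 <= a ->
  (a *: x) `/\` (a *: y) = a *: (x `/\` y).
Proof.
rewrite le_eqVlt => /predU1P[<-|a0].
  by rewrite !scale0r; apply: vle_anti; rewrite vinf_lel vle_infP vle_refl.
apply: vle_anti; apply/andP; split; last first.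
  by rewrite vle_infP !vle_scalePl// vinf_lel vinf_ler.
have ai0 : 0 < a^-1 by rewrite invr_gt0.
rewrite -(vle_scalePl _ _ ai0) scalerA mulVf ?gt_eqF// scale1r vle_infP.
apply/andP; split.
  by rewrite -(vle_scalePl _ _ a0) scalerA divff ?gt_eqF// scale1r vinf_lel.
by rewrite -(vle_scalePl _ _ a0) scalerA divff ?gt_eqF// scale1r vinf_ler.
Qed.

Lemma disjoint_eltsC x y : disjoint_elts x y -> disjoint_elts y x.
Proof. by rewrite /disjoint_elts vinfC. Qed.

Lemma disjoint_elts_le x y : |`x| `/\` |`y| <=v 0 -> disjoint_elts x y.
Proof. by move=> xy; apply: vle_anti; rewrite xy vinf_ge0 ?modulus_ge0. Qed.

Lemma disjoint_elts0 x : disjoint_elts 0 x.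
Proof. by apply: disjoint_elts_le; rewrite -[X in _ <=v X]modulus0 vinf_lel. Qed.

Lemma disjoint_elts_sub (a : R) x y z :
  |`x| <=v a *: |`y| -> disjoint_elts y z -> disjoint_elts x z.
Proof.
move=> xy yz; apply: disjoint_elts_le.
(* This factor exceeds both [a] and 1, so it scales both sides of the infimum and can be pulled
   out. *)
have a1 : 0 < `|a| + 1 by rewrite ltr_pwDr.
have z0 := modulus_ge0 z; have y0 := modulus_ge0 y.
have : |`x| `/\` |`z| <=v ((`|a| + 1) *: |`y|) `/\` ((`|a| + 1) *: |`z|).
  apply: vle_inf2; last by rewrite -{1}[|`z|]scale1r vle_scale2r// lerDr.
  by rewrite (vle_le_trans xy)// vle_scale2r// (le_trans (ler_norm _))// lerDl.
by rewrite vinf_scale ?ltW// yz scaler0.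
Qed.

Lemma disjoint_eltsD x y z :
  disjoint_elts x z -> disjoint_elts y z -> disjoint_elts (x + y) z.
Proof.
move=> xz yz; apply: disjoint_elts_le.
apply: vle_le_trans (vle_inf2 (modulusD x y) (vle_refl _)) _.
apply: vle_le_trans (vle_infD _ _ _) _; rewrite ?modulus_ge0//.
by rewrite [_ `/\` _]xz [_ `/\` _]yz addr0 vle_refl.
Qed.

(** The sum of disjoint moduli is their supremum, so each modulus alone is compared with that of the
    sum: [|z| - |z + t|] is below both [|z|] and [|t|], hence below 0. *)
Lemma disjoint_modulusD x y :
  disjoint_elts x y -> |`x| + |`y| <=v |`x + y|.
Proof.
have le z t : disjoint_elts z t -> |`z| <=v |`z + t|.
  move=> zt; rewrite -[X in _ <=v X]addr0 -zt addrC -vle_subl_addr vle_infP.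
  rewrite vle_subl_addr addrC vle_addl ?modulus_ge0//= vle_subl_addr addrC.
  by rewrite -{1}[z](addrK t) -(modulusN t) modulusD.
move=> xy; rewrite -(vinf_add_sup |`x| |`y|) xy add0r vle_supP le//.
by rewrite addrC le//; exact: disjoint_eltsC.
Qed.

Lemma disjoint_modulusD_le x y w : disjoint_elts x y ->
  |`x| <=v w -> |`y| <=v w -> |`x + y| <=v w.
Proof.
move=> xy xw yw; apply: vle_le_trans (modulusD x y) _.
by rewrite -(vinf_add_sup |`x| |`y|) xy add0r vle_supP xw.
Qed.

Lemma riesz_decomposition x y z : |`z| <=v |`x| + |`y| ->
  exists z1 z2, [/\ z = z1 + z2, |`z1| <=v |`x| & |`z2| <=v |`y|].
Proof.
move=> zxy; have x0 := modulus_ge0 x; have y0 := modulus_ge0 y.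
move: zxy; rewrite modulus_le => /andP[zxy Nzxy].
(* [z1] is [z] truncated to the order interval from [-|x|] to [|x|]. *)
pose z1 := (z `/\` |`x|) `\/` (- |`x|).
exists z1, (z - z1); rewrite subrKC; split => //.
  rewrite modulus_le vle_supP vinf_ler/= -[X in _ && (_ <=v X)]opprK vleN.
  by rewrite vle_supr (vle_le_trans _ x0)// -oppr0 vleN.
rewrite modulus_le opprB !vle_subl_addr; apply/andP; split.
  rewrite addrC -vle_subl_addr (vle_le_trans _ (vle_supl _ _))// vle_infP.
  by rewrite !vle_subl_addr addrC vle_addl.
rewrite vle_supP (vle_le_trans (vinf_lel _ _)) ?vle_addl//=.
by rewrite -vle_subl_addr [X in X <=v _]addrC vle_subl_addr [X in _ <=v X]addrC.
Qed.

End BanachLatticeTheory.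

(** * Compactness in the space of bounded sequences *)

(** An ultrafilter contains the preimage of a neighbourhood or that of its complement, so a cluster
    point of the image is a limit. *)
Lemma compact_ultra_fmap_cvg (T : Type) (U : topologicalType) (f : T -> U)
    (F : set_system T) (K : set U) : UltraFilter F -> compact K ->
  F (f @^-1` K) -> exists2 l, K l & f @ F --> l.
Proof.
move=> FU Kc FK; have [l [Kl clus]] := Kc (f @ F) _ FK.
exists l => // B lB; have [//|FB] := in_ultra_setVsetC (f @^-1` B) FU.
by have [y [nBy By]] := clus (~` B) B FB lB.
Qed.

Section Linfty.
Context {R : realType}.

(** An ultrafilter on the box converges in each coordinate. As [c] tends to 0, the tails are
    uniformly small, so norm convergence involves only finitely many coordinates. *)
Lemma linfty_box_compact (c : nat -> R) : c @ \oo --> 0 ->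
  compact [set v : linfty R | forall n, `|v n| <= c n].
Proof.
move=> c0; rewrite compact_ultra => F FU Fbox.
have [l lP] : {l : nat -> R^o & forall n,
    `|l n| <= c n /\ (fun v : linfty R => v n) @ F --> l n}.
  apply: (choice (P := fun n (l : R^o) => `|l| <= c n /\
    (fun v : linfty R => v n) @ F --> l)) => n.
  have [|l lc Fl] := compact_ultra_fmap_cvg (f := fun v : linfty R => v n) FU
    (@segment_compact R (- c n) (c n)).
    by apply: filterS Fbox => v /(_ n); rewrite ler_norml /= in_itv.
  by exists l; split => //; rewrite ler_norml; move: lc; rewrite /= in_itv.
have lb : l \in bounded_seq.
  apply/bounded_seqP.
  have [M [_ cM]] := cvg_seq_bounded (cvgP _ c0).
  exists (M + 1) => n; rewrite (le_trans (lP n).1)//.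
  by rewrite (le_trans (ler_norm _))//; apply: cM => //; rewrite ltrDl.
exists (Linfty lb); split => [n|]; first exact: (lP n).1.
apply/cvgrPdist_le => e e0.
have e20 : 0 < e / 2 by rewrite divr_gt0.
have [N _ cN] := cvgr0_norm_le _ c0 _ e20.
have FN : F [set v : linfty R | forall i : 'I_N, `|l i - v i| <= e].
  apply: filter_forall => i.
  by have /cvgrPdist_le/(_ _ e0) := (lP i).2.
apply: filterS2 FN Fbox => v vN vc; apply: linfty_norm_le => n.
have [nN|Nn] := ltnP n N; first exact: (vN (Ordinal nN)).
have cn : c n <= e / 2 by rewrite (le_trans (ler_norm _))// cN.
rewrite (le_trans (ler_normB _ _))// (splitr e) lerD//.
  by rewrite (le_trans (lP n).1).
by rewrite (le_trans (vc n)).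
Qed.

Lemma linfty_box_precompact (A : set (linfty R)) (c : nat -> R) :
  c @ \oo --> 0 -> (forall v, A v -> forall n, `|v n| <= c n) -> precompact A.
Proof.
move=> c0 Ac; exists [set v : linfty R | forall n, `|v n| <= c n] => //.
have cc := linfty_box_compact c0; split => //.
by apply: compact_closed => //; exact: norm_hausdorff.
Qed.

(** Terms of norm at least [e] at arbitrarily large indices would have a cluster point, which must
    vanish in every coordinate and yet stay at distance from 0. *)
Lemma linfty_precompact_cvg0 (v : nat -> linfty R) :
  precompact (range v) -> (forall m, (fun n => v n m) @ \oo --> (0 : R)) ->
  (fun n => `|v n|) @ \oo --> (0 : R).
Proof.
move=> [K vK [Kc _]] v0; apply/cvgr0Pnorm_lt => e e0.
apply: contrapT => vfar.
(* [s] need not be increasing: [n <= s n] is enough to carry eventual properties of [v] over to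
   [v \o s]. *)
have [s sP] : {s : nat -> nat & forall n, (n <= s n)%N /\ e <= `|v (s n)|}.
  apply: (choice (P := fun n m => (n <= m)%N /\ e <= `|v m|)) => N.
  apply: contrapT => vN; apply: vfar; exists N => // n /= Nn.
  by rewrite normr_id ltNge; apply/negP => vn; apply: vN; exists n.
have sv A : (\forall n \near \oo, A (v n)) -> \forall n \near \oo, A (v (s n)).
  by move=> [N _ NA]; exists N => // n /= Nn; apply: NA; exact: leq_trans (sP n).1.
have [|l [Kl clus]] := Kc ((v \o s) @ \oo) _.
  by exists 0%N => // n _; apply: vK; exists (s n).
have l0 : l = 0.
  apply/val_inj/funext => m; apply/eqP; rewrite -normr_le0.
  apply/ler_addgt0Pl => d d0; rewrite addr0.
  have d20 : 0 < d / 2 by rewrite divr_gt0.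
  have [w [/= wd lw]] := clus [set w : linfty R | `|w m| < d / 2] (ball l (d / 2))
    (sv _ (cvgr0_norm_lt _ (v0 m) _ d20)) (nbhsx_ballx _ _ d20).
  move: lw; rewrite -ball_normE/= => lw.
  rewrite -[l m](subrK (w m)) (splitr d) (le_trans (ler_normD _ _))// lerD ?ltW//.
  exact: le_lt_trans (le_linfty_norm (l - w) m) lw.
have [|w [/= ew]] := clus [set w | e <= `|w|] (ball l e) _ (nbhsx_ballx _ _ e0).
  by exists 0%N => // n _; exact: (sP n).2.
by rewrite -ball_normE /= l0 sub0r normrN ltNge ew.
Qed.

End Linfty.

(** * Disjoint sequences and functionals *)

Section DisjointSequences.
Context {R : realType} {E : banachLatticeType R}.

Lemma disjoint_eltsZ (a b : R) (x y : E) :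
  disjoint_elts x y -> disjoint_elts (a *: x) (b *: y).
Proof.
have dZ c (z t : E) : disjoint_elts z t -> disjoint_elts (c *: z) t.
  by apply: (@disjoint_elts_sub _ _ `|c|); rewrite modulusZ vle_refl.
by move=> xy; apply: (dZ); apply: disjoint_eltsC; apply: (dZ); exact: disjoint_eltsC.
Qed.

Lemma disjoint_sum (u : nat -> E) (a : nat -> R) n : disjoint_seq u ->
  disjoint_elts (\sum_(i < n) a i *: u i) (a n *: u n).
Proof.
move=> du; apply: (big_ind (fun x => disjoint_elts x (a n *: u n))) => [|x y|i _].
- exact: disjoint_elts0.
- exact: disjoint_eltsD.
- by apply: disjoint_eltsZ; apply: du; rewrite neq_ltn ltn_ord.
Qed.

(** A sum of disjoint elements has as modulus the supremum of their moduli, so the bound does not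
    grow with [n]. *)
Lemma disjoint_sum_le (u : nat -> E) (w : E) n : disjoint_seq u ->
  (forall i, vle (modulus (u i)) (modulus w)) ->
  vle (modulus (\sum_(i < n) u i)) (modulus w).
Proof.
move=> du uw; elim: n => [|n IHn]; first by rewrite big_ord0 modulus0 modulus_ge0.
rewrite big_ord_recr/= disjoint_modulusD_le//.
have := disjoint_sum (fun=> 1) n du; rewrite /= scale1r.
by under eq_bigr do rewrite scale1r.
Qed.

End DisjointSequences.

(** * The seminorm attached to a principal band *)

Section BandSeminorm.
Context {R : realType} {E : banachLatticeType R}.
Implicit Types x y u : E.

Lemma norm_vle x y : vle 0 x -> vle x y -> `|x| <= `|y|.
Proof.
by move=> x0 xy; apply: vle_norm; apply: vle_le_trans _ (vle_modulus y);
  rewrite -/(modulus x) ger0_modulus.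
Qed.

Lemma modulus_vinf x y : vle 0 x -> vle 0 y -> modulus (vinf x y) = vinf x y.
Proof. by move=> x0 y0; rewrite ger0_modulus ?vinf_ge0. Qed.

(* The norm of the component of [x] in the band generated by [u], as the
   components [|x| /\ k |u|] increase with [k]. *)
Definition band_norm u x : R :=
  sup [set `|vinf (modulus x) (k *: modulus u)| | k in [set k | 0 <= k]].

Let scale_ge0 (k : R) u : 0 <= k -> vle 0 (k *: modulus u).
Proof. by move=> k0; rewrite -(scaler0 _ k) vle_scale ?modulus_ge0. Qed.

Let vinf_norm_le u x k : 0 <= k -> `|vinf (modulus x) (k *: modulus u)| <= `|x|.
Proof.
move=> k0; rewrite -[leRHS]norm_modulus norm_vle ?vinf_lel// vinf_ge0//.
  exact: modulus_ge0.
exact: scale_ge0.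
Qed.

Lemma le_band_norm u x k : 0 <= k ->
  `|vinf (modulus x) (k *: modulus u)| <= band_norm u x.
Proof.
move=> k0; apply: ub_le_sup; last by exists k.
by exists `|x| => _ [j j0 <-]; exact: vinf_norm_le.
Qed.

Lemma band_norm_le u x r :
  (forall k, 0 <= k -> `|vinf (modulus x) (k *: modulus u)| <= r) ->
  band_norm u x <= r.
Proof.
move=> xr; apply: ge_sup; last by move=> _ [k k0 <-]; exact: xr.
by exists `|vinf (modulus x) (0 *: modulus u)|, 0 => /=.
Qed.

Lemma band_norm_le_norm u x : band_norm u x <= `|x|.
Proof. by apply: band_norm_le => k; exact: vinf_norm_le. Qed.

Lemma band_norm_ge u : `|u| <= band_norm u u.
Proof.
have := @le_band_norm u u 1 ler01.
suff -> : vinf (modulus u) (1 *: modulus u) = modulus u by rewrite norm_modulus.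
by rewrite scale1r; apply: vle_anti; rewrite vinf_lel vle_infP !vle_refl.
Qed.

Lemma band_normN u x : band_norm u (- x) = band_norm u x.
Proof. by rewrite /band_norm modulusN. Qed.

Lemma band_norm_sublinear u : sublinear (band_norm u).
Proof.
have u0 := modulus_ge0 u; split=> [x y|a x].
  apply: band_norm_le => k k0; have ku0 := scale_ge0 u k0.
  apply: le_trans (lerD (le_band_norm u x k0) (le_band_norm u y k0)).
  apply: le_trans (ler_normD _ _); apply: norm_vle.
    by rewrite vinf_ge0 ?modulus_ge0.
  apply: vle_le_trans (vle_inf2 (modulusD x y) (vle_refl _)) _.
  by rewrite vle_infD ?modulus_ge0.
rewrite le_eqVlt => /predU1P[<-|a0].
  rewrite mul0r scale0r (le_trans (band_norm_le_norm _ _))//.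
  by rewrite normr0.
apply: band_norm_le => k k0.
have ka0 : 0 <= a^-1 * k by rewrite mulr_ge0// invr_ge0 ltW.
(* Rescaling the parameter [k] lets [a] factor out of the infimum. *)
have -> : k = a * (a^-1 * k) by rewrite mulrA divff ?gt_eqF// mul1r.
rewrite modulusZ gtr0_norm// -scalerA vinf_scale ?(ltW a0)// normrZ gtr0_norm//.
by rewrite ler_wpM2l ?(ltW a0)// le_band_norm.
Qed.

End BandSeminorm.

(** * The modulus of a bounded functional *)

Section AbsFunctional.
Context {R : realType} {E : banachLatticeType R}.
Variable f : {linear E -> R^o}.
Hypothesis f_bounded : bounded_operator f.
Implicit Types x y : E.

(* The value of the modulus [|f|] of the functional [f] at [|x|]. *)
Definition abs_functional x : R :=
  sup [set f y | y in [set y | vle (modulus y) (modulus x)]].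

Let p := abs_functional.

Lemma abs_functional_le x r :
  (forall y, vle (modulus y) (modulus x) -> f y <= r) -> p x <= r.
Proof.
move=> xr; apply: ge_sup; last by move=> _ [y yx <-]; exact: xr.
by exists (f x), x => //=; exact: vle_refl.
Qed.

Lemma abs_functional_bounded : exists M, forall x, p x <= M * `|x|.
Proof.
have [M fM] := f_bounded; exists `|M| => x; apply: abs_functional_le => y yx.
rewrite (le_trans (ler_norm _))// (le_trans (fM y))//.
rewrite (@le_trans _ _ (`|M| * `|y|)) ?ler_wpM2r ?ler_norm//.
by rewrite ler_wpM2l// vle_norm.
Qed.

Lemma le_abs_functional x y : vle (modulus y) (modulus x) -> f y <= p x.
Proof.
move=> yx; apply: ub_le_sup; last by exists y.
have [M fM] := f_bounded; exists (`|M| * `|x|) => _ [z /= zx <-].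
rewrite (le_trans (ler_norm _))// (le_trans (fM z))//.
rewrite (@le_trans _ _ (`|M| * `|z|)) ?ler_wpM2r ?ler_norm//.
by rewrite ler_wpM2l// vle_norm.
Qed.

Lemma abs_functional_ge0 x : 0 <= p x.
Proof. by rewrite -(linear0 f) le_abs_functional// modulus0 modulus_ge0. Qed.

Lemma abs_functional_mono x y : vle (modulus x) (modulus y) -> p x <= p y.
Proof.
by move=> xy; apply: abs_functional_le => z zx; apply: le_abs_functional;
  exact: vle_le_trans xy.
Qed.

Lemma abs_functionalN x : p (- x) = p x.
Proof. by rewrite /p /abs_functional modulusN. Qed.

Lemma norm_le_abs_functional x : `|f x| <= p x.
Proof.
apply: linear_norm_le => [|z]; first exact: abs_functionalN.
exact/le_abs_functional/vle_refl.
Qed.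

Lemma abs_functionalZ_le a x : 0 <= a -> p (a *: x) <= a * p x.
Proof.
rewrite le_eqVlt => /predU1P[<-|a0].
  rewrite scale0r mul0r; apply: abs_functional_le => y; rewrite modulus0 => y0.
  suff -> : y = 0 by rewrite linear0.
  have y00 : modulus y = 0 by apply: vle_anti; rewrite y0 modulus_ge0.
  by apply/eqP; rewrite -normr_eq0 -norm_modulus y00 normr0.
apply: abs_functional_le => y; rewrite modulusZ gtr0_norm// => yax.
have -> : y = a *: (a^-1 *: y) by rewrite scalerA divff ?gt_eqF// scale1r.
rewrite linearZ /= ler_wpM2l ?(ltW a0)// le_abs_functional// modulusZ.
rewrite gtr0_norm ?invr_gt0// -(vle_scalePl _ _ a0) scalerA divff ?gt_eqF//.
by rewrite scale1r.
Qed.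

(** Riesz decomposition splits any competitor for [x + y] into competitors for [x] and for [y]. *)
Lemma abs_functional_sublinear : sublinear p.
Proof.
split; last exact: abs_functionalZ_le.
move=> x y; apply: abs_functional_le => z zxy.
have [z1 [z2 [-> z1x z2y]]] := riesz_decomposition (vle_le_trans zxy (modulusD x y)).
by rewrite linearD lerD// le_abs_functional.
Qed.

(** Competitors for [x] and [y] add up to one for [x + y], since disjointness gives
    [|x| + |y| <= |x + y|]. *)
Lemma abs_functionalD_disjoint x y : disjoint_elts x y -> p x + p y <= p (x + y).
Proof.
move=> xy; rewrite -lerBrDr; apply: abs_functional_le => x' x'x.
rewrite lerBrDr addrC -lerBrDr; apply: abs_functional_le => y' y'y.
rewrite lerBrDr addrC -linearD le_abs_functional//.
apply: vle_le_trans (disjoint_modulusD xy); apply: vle_le_trans (modulusD _ _) _.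
exact: vle_add.
Qed.

Lemma abs_functional_sum_disjoint (u : nat -> E) (a : nat -> R) n :
  disjoint_seq u -> (forall i, 0 <= a i) ->
  \sum_(i < n) a i * p (u i) <= p (\sum_(i < n) a i *: u i).
Proof.
move=> du a0; elim: n => [|n IHn].
  by rewrite !big_ord0 abs_functional_ge0.
rewrite !big_ord_recr/= -sublinearZ//; last exact: abs_functional_sublinear.
apply: le_trans (lerD IHn (lexx _)) _; apply: abs_functionalD_disjoint.
exact: disjoint_sum.
Qed.

End AbsFunctional.

(** * Disjoint weakly null sequences under the modulus of a functional *)

Section DisjointWeaklyNull.
Context {R : realType} {E : banachLatticeType R}.
Implicit Types (f : {linear E -> R^o}) (u v : nat -> E).

(* Mazur-Orlicz applies to the cone spanned by the [(u n, |f| |u n|)], because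
   [|f|] is additive on disjoint elements; the functional [g] obtained satisfies
   [|f| |u n| <= g (u n)]. *)
Lemma disjoint_weakly_null_abs f u : bounded_operator f ->
  disjoint_seq u -> weakly_cvg u 0 -> abs_functional f \o u @ \oo --> (0 : R).
Proof.
move=> fb du u0; set p := abs_functional f.
have sp : sublinear p by exact: abs_functional_sublinear.
pose comb (a : nat -> R) n := (\sum_(i < n) a i *: u i, \sum_(i < n) a i * p (u i)).
pose S := [set z | exists2 a : nat -> R,
  (forall i, 0 <= a i) & exists n, z = comb a n].
(* Padding coefficients with zeros brings two combinations to a common length, so that they can be
   added. *)
have widen a n m : (n <= m)%N ->
    comb a n = comb (fun i => if (i < n)%N then a i else 0) m.
  move=> nm; rewrite /comb; congr pair.
    rewrite (big_ord_widen _ (fun i => a i *: u i) nm) big_mkcond.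
    by apply: eq_bigr => i _; case: ifP; rewrite ?scale0r.
  rewrite (big_ord_widen _ (fun i => a i * p (u i)) nm) big_mkcond.
  by apply: eq_bigr => i _; case: ifP; rewrite ?mul0r.
have cS : cone S.
  split=> [|_ _ [a a0 [n ->]] [b b0 [m ->]]|c _ c0 [a a0 [n ->]]].
  - by exists (fun=> 0) => //; exists 0%N; rewrite /comb !big_ord0.
  - exists (fun i =>
      (if (i < n)%N then a i else 0) + (if (i < m)%N then b i else 0)).
      by move=> i; rewrite addr_ge0//; case: ifP.
    exists (maxn n m); rewrite (widen a _ (maxn n m)) ?leq_maxl//.
    rewrite (widen b _ (maxn n m)) ?leq_maxr//.
    congr pair => /=; rewrite -big_split/=; apply: eq_bigr => i _.
      by rewrite scalerDl.
    by rewrite mulrDl.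
  - exists (fun i => c * a i); first by move=> i; rewrite mulr_ge0.
    exists n; congr pair => /=.
      by rewrite scaler_sumr; apply: eq_bigr => i _; rewrite scalerA.
    by rewrite mulr_sumr; apply: eq_bigr => i _; rewrite mulrA.
have Sp z : S z -> z.2 <= p z.1.
  by move=> [a a0 [n ->]] /=; exact: abs_functional_sum_disjoint.
have [g [gp gS]] := mazur_orlicz sp cS Sp.
have gb : bounded_operator g.
  have [M pM] := abs_functional_bounded fb.
  exists M => x; apply: le_trans (pM x).
  by apply: linear_norm_le => [y|//]; exact: abs_functionalN.
have pg n : p (u n) <= g (u n).
  have : S (u n, p (u n)).
    (* The indicator of [n], summed over the first [n.+1] indices, yields the single pair for
       [u n]. *)
    exists (fun i => (i == n)%:R) => [i|]; first by case: eqP.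
    exists n.+1; rewrite /comb !big_ord_recr/= eqxx scale1r mul1r.
    by rewrite !big1 ?add0r// => i _; rewrite ltn_eqF ?scale0r ?mul0r.
  by move=> /gS.
have := u0 g gb; rewrite linear0 => gu0.
apply: (squeeze_cvgr _ (cvg_cst 0) gu0); apply: nearW => n /=.
by rewrite pg andbT; exact: abs_functional_ge0.
Qed.

(** By superadditivity on disjoint elements, the series of the values [|f| |u n|] has partial sums
    bounded by [|f| |w|]; it converges, so its terms tend to 0. *)
Lemma order_bounded_disjoint_abs f u (w : E) : bounded_operator f ->
  disjoint_seq u -> (forall n, vle (modulus (u n)) (modulus w)) ->
  abs_functional f \o u @ \oo --> (0 : R).
Proof.
move=> fb du uw; apply: cvg_series_cvg_0; apply: nondecreasing_is_cvgn.
  apply/nondecreasing_seqP => n; rewrite /series/= big_nat_recr//= lerDl.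
  exact: abs_functional_ge0.
exists (abs_functional f w) => _ [n _ <-]; rewrite /series/= big_mkord.
have := abs_functional_sum_disjoint fb n du (fun=> ler01).
under eq_bigr do rewrite mul1r.
under [X in _ <= _ X -> _]eq_bigr do rewrite scale1r.
move=> /le_trans; apply; apply: abs_functional_mono => //.
exact: disjoint_sum_le.
Qed.

(** Let [|v n| <= |u (k n)|], where [k] may repeat values. When [k n] is large, [|f| |u (k n)|] is
    already small; the remaining [v n] are disjoint and order bounded by the sum of finitely many
    [|u i|]. *)
Lemma disjoint_weakly_null_range u : disjoint_seq u -> weakly_cvg u 0 ->
  bounded_set (range u) -> disjointly_weakly_compact (range u).
Proof.
move=> du u0 ub; split => // v vu dv f fb; rewrite linear0.
have [k vk] : {k : nat -> nat & forall n, vle (modulus (v n)) (modulus (u (k n)))}.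
  apply: (choice (P := fun n m => vle (modulus (v n)) (modulus (u m)))) => n.
  by have [_ [m _ <-] vm] := vu n; exists m.
apply/cvgr0Pnorm_le => e e0.
have [N _ uN] := cvgr0_norm_le _ (disjoint_weakly_null_abs fb du u0) _ e0.
pose w := \sum_(i < N) modulus (u i).
have w0 (s : seq 'I_N) : vle 0 (\sum_(i <- s) modulus (u i)).
  elim: s => [|i s IHs]; first by rewrite big_nil vle_refl.
  by rewrite big_cons -[X in vle X _]addr0 vle_add ?modulus_ge0.
(* Zeros in place of the other terms preserve disjointness and avoid passing to a subsequence. *)
pose v' n := if (k n < N)%N then v n else 0.
have dv' : disjoint_seq v'.
  move=> m n mn; rewrite /v'; case: ifP => _; last exact: disjoint_elts0.
  by case: ifP => _; [exact: dv|exact/disjoint_eltsC/disjoint_elts0].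
have v'w n : vle (modulus (v' n)) (modulus w).
  rewrite /v'; case: ifPn => kN; last by rewrite modulus0 modulus_ge0.
  apply: vle_le_trans (vk n) _; rewrite [modulus w]ger0_modulus; last exact: w0.
  by rewrite /w (bigD1 (Ordinal kN))//= addrC vle_addl// -big_filter w0.
have := order_bounded_disjoint_abs fb dv' v'w.
move=> /cvgr0_norm_le/(_ _ e0); apply: filterS => n /=.
rewrite /v'; case: ifPn => [_|].
  by apply: le_trans; rewrite (le_trans (norm_le_abs_functional fb _))// ler_norm.
rewrite -leqNgt => Nk _; apply: le_trans (uN _ Nk) => /=.
rewrite (le_trans (norm_le_abs_functional fb _))//.
by rewrite (le_trans _ (ler_norm _))// abs_functional_mono.
Qed.

(* Dividing by [max 1 ||u n||] makes the sequence bounded without appealing to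
   the uniform boundedness principle. *)
Lemma positive_Schur_bounded :
  (forall u, disjoint_seq u -> weakly_cvg u 0 -> bounded_set (range u) ->
     (fun n => `|u n|) @ \oo --> (0 : R)) -> positive_Schur E.
Proof.
move=> Eb u du u0; pose c n := (Num.max 1 `|u n|)^-1.
have c0 n : 0 < Num.max 1 `|u n| by rewrite lt_max ltr01.
have cge0 n : 0 <= c n by rewrite invr_ge0 ltW.
have cle1 n : c n <= 1 by rewrite invf_le1// le_max lexx.
have cu1 n : `|c n *: u n| = `|u n| / Num.max 1 `|u n|.
  by rewrite normrZ (ger0_norm (cge0 n)) mulrC.
have /cvgr0Pnorm_lt cu0 : (fun n => `|c n *: u n|) @ \oo --> (0 : R).
  apply: Eb.
  - by move=> m n mn; apply: disjoint_eltsZ; exact: du.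
  - move=> f fb; rewrite linear0; apply/norm_cvg0P.
    have fu0 : (fun n => `|f (u n)|) @ \oo --> (0 : R).
      by apply/norm_cvg0P; have := u0 f fb; rewrite linear0.
    apply: (squeeze_cvgr _ (cvg_cst 0) fu0); apply: nearW => n /=.
    by rewrite normr_ge0/= linearZ/= normrM (ger0_norm (cge0 n)) ler_piMl.
  - exists 1; split => // M M1 _ [n _ <-]; rewrite /= cu1 (le_trans _ (ltW M1))//.
    by rewrite ler_pdivrMr// mul1r le_max lexx orbT.
(* If [||u n|| > 1], the rescaled vector has norm exactly 1; a norm below 1 thus forces
   [||u n|| <= 1], where rescaling changes nothing. *)
apply/cvgr0Pnorm_lt => e e0; have m0 : 0 < Num.min 1 e by rewrite lt_min ltr01.
apply: filterS (cu0 _ m0) => n; rewrite !normr_id cu1.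
have [un1|un1] := leP `|u n| 1; last first.
  by rewrite divff ?gt_eqF ?lt_min ?ltxx// (lt_trans _ un1).
by rewrite divr1 lt_min => /andP[].
Qed.

End DisjointWeaklyNull.

(** * The operator attached to a disjoint sequence *)

Section BandOperator.
Context {R : realType} {E : banachLatticeType R}.

(** For each [n] at which the bound fails, pick [x] in [A] and [k] with [|x| /\ k |u n|] of norm
    above [e]. These elements lie in [Sol A] and are disjoint like the [u n], so their norms tend to
    0 and failure stops. *)
Lemma L_weakly_compact_band_norm (A : set E) (u : nat -> E) :
  L_weakly_compact A -> disjoint_seq u -> forall e, 0 < e ->
  \forall n \near \oo, forall x, A x -> band_norm (u n) x <= e.
Proof.
move=> [_ A0] du e e0.
have [->|/set0P[x0 Ax0]] := eqVneq A set0; first by apply: nearW => n x.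
pose far n (z : E * R) := [/\ A z.1, 0 <= z.2 &
  (exists2 x, A x & e < band_norm (u n) x) ->
    e < `|vinf (modulus z.1) (z.2 *: modulus (u n))|].
have [z zP] : {z : nat -> E * R & forall n, far n (z n)}.
  apply: (choice (P := far)) => n.
  have [[x Ax ex]|nx] := pselect (exists2 x, A x & e < band_norm (u n) x).
    have [k k0 ek] : exists2 k, 0 <= k &
        e < `|vinf (modulus x) (k *: modulus (u n))|.
      apply: contrapT => nk; move: ex; rewrite ltNge => /negP; apply.
      apply: band_norm_le => k k0; rewrite leNgt; apply/negP => ek.
      by apply: nk; exists k.
    by exists (x, k); split.
  (* Where the bound holds, a default pair in [A] with [k = 0] keeps the sequence total. *)
  by exists (x0, 0); split => // /nx.
pose y n := vinf (modulus (z n).1) ((z n).2 *: modulus (u n)).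
have zu0 n : vle 0 ((z n).2 *: modulus (u n)).
  by have [_ z0 _] := zP n; rewrite -(scaler0 _ (z n).2) vle_scale ?modulus_ge0.
have my n : modulus (y n) = y n by rewrite modulus_vinf ?modulus_ge0.
have /cvgr0_norm_lt/(_ _ e0) : (fun n => `|y n|) @ \oo --> (0 : R).
  apply: A0 => [n|m n mn].
    by have [Az _ _] := zP n; exists (z n).1; rewrite // my vinf_lel.
  have yu i : vle (modulus (y i)) ((z i).2 *: modulus (u i)) by rewrite my vinf_ler.
  apply: disjoint_elts_sub (yu m) _; apply: disjoint_eltsC.
  by apply: disjoint_elts_sub (yu n) _; apply: du; rewrite eq_sym.
apply: filterS => n; rewrite normr_id => yn x Ax; rewrite leNgt; apply/negP => ex.
have [_ _ zn] := zP n.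
by have := lt_trans yn (zn (ex_intro2 _ _ x Ax ex)); rewrite ltxx.
Qed.

(** The bound of [f n] by the norm makes [T] bounded into the bounded sequences; the bound by
    [band_norm (u n)] makes it LW-compact. Coordinates are exposed as bounded functionals so that
    weak nullity can be tested on them. *)
Lemma band_operator (u : nat -> E) : disjoint_seq u ->
  exists2 T : {linear E -> linfty R}, LW_compact T &
    forall n, `|u n| <= `|T (u n)| /\
      exists2 f : {linear E -> R^o}, bounded_operator f & forall x, T x n = f x.
Proof.
move=> du.
have [f fP] : {f : nat -> {linear E -> R^o} & forall n,
    (forall x, `|f n x| <= band_norm (u n) x) /\ `|u n| <= f n (u n)}.
  apply: (choice (P := fun n (f : {linear E -> R^o}) =>
    (forall x, `|f x| <= band_norm (u n) x) /\ `|u n| <= f (u n))) => n.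
  have [f [fp fu]] := hahn_banach_at (u n) (band_norm_sublinear (u n)).
  exists f; split; last exact: le_trans (band_norm_ge _) fu.
  by apply: linear_norm_le => // x; exact: band_normN.
have f1 n x : `|f n x| <= `|x|.
  exact: le_trans ((fP n).1 x) (band_norm_le_norm _ _).
have fb x : (fun n => f n x) \in bounded_seq.
  by apply/bounded_seqP; exists `|x|.
pose T0 x := Linfty (fb x).
have T0lin : linear T0.
  by move=> a x y; apply/val_inj/funext => n /=; rewrite linearP.
pose F := GRing.isLinear.Build R E (linfty R) *:%R T0 T0lin.
pose T : {linear E -> linfty R} := HB.pack_for {linear E -> linfty R} T0 F.
have T1 x : `|T x| <= `|x| by apply: linfty_norm_le => n; exact: f1.
exists T; last first.
  move=> n; split; last by exists (f n) => //; exists 1 => x; rewrite mul1r.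
  apply: le_trans (le_linfty_norm (T (u n)) n).
  by apply: le_trans (fP n).2 _; exact: ler_norm.
split=> [|A LA]; first by exists 1 => x; rewrite mul1r.
(* The radii of the box below are suprema over [A], which require a point of [A]. *)
have [A0|/set0P[x0 Ax0]] := eqVneq A set0.
  rewrite A0 image_set0; apply: (linfty_box_precompact (c := fun=> 0)) => //.
  exact: cvg_cst.
have [[M [_ AM]] _] := LA.
pose B n := [set band_norm (u n) x | x in A].
have Bsup n : has_sup (B n).
  split; first by exists (band_norm (u n) x0), x0.
  exists (M + 1) => _ [x Ax <-]; rewrite (le_trans (band_norm_le_norm _ _))//.
  by apply: AM => //; rewrite ltrDl.
apply: (linfty_box_precompact (c := fun n => sup (B n))).
  apply/cvgr0Pnorm_le => e e0.
  apply: filterS (L_weakly_compact_band_norm LA du e0) => n Ae.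
  rewrite ger0_norm.
    by apply: ge_sup; [case: (Bsup n)|move=> _ [x Ax <-]; exact: Ae].
  apply: (@le_trans _ _ (band_norm (u n) x0)).
    exact: le_trans ((fP n).1 x0).
  by apply: sup_upper_bound => //; exists x0.
move=> _ [x Ax <-] n; apply: le_trans ((fP n).1 x) _.
by apply: sup_upper_bound => //; exists x.
Qed.

End BandOperator.

Theorem theorem2p10 (R : realType) (E : banachLatticeType R) :
  [<-> positive_Schur E ;
       forall (X : completeNormedModType R) (T : {linear E -> X}),
         LW_compact T -> DW_compact T ;
       forall T : {linear E -> linfty R}, LW_compact T -> DW_compact T ].
Proof.
tfae.
(* A disjoint sequence in [Sol A] is weakly null, hence norm null: [A] is L-weakly compact. *)
- move=> PS X T [Tb TL]; split => // A [Ab AD]; apply: TL; split => // u Au du.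
  by apply: PS => //; exact: AD.
- by move=> XT T; exact: XT.
- move=> LD; apply: positive_Schur_bounded => u du u0 ub.
  have [T TLW Tu] := band_operator du.
  have [_ /(_ _ (disjoint_weakly_null_range du u0 ub))] := LD T TLW.
  rewrite image_comp => TuK.
  have Tu0 : (fun n => `|T (u n)|) @ \oo --> (0 : R).
    (* Each coordinate of [T (u n)] is a fixed bounded functional applied to the weakly null [u]. *)
    apply: linfty_precompact_cvg0 => // m.
    have [_ [f fb Tf]] := Tu m; rewrite -(linear0 f).
    by under eq_fun do rewrite Tf; exact: u0.
  apply: (squeeze_cvgr _ (cvg_cst 0) Tu0); apply: nearW => n.
  by rewrite normr_ge0; exact: (Tu n).1.
Qed.
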